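(* Let $d\ge2$. For $f,g\in C^1(\mathbb{S}^{d-1})$ and $1\le i\ne j\le d$, $$\int_{\mathbb{S}^{d-1}}f(x)\,D_{i,j}g(x)\,d\sigma(x)=-\int_{\mathbb{S}^{d-1}}D_{i,j}f(x)\,g(x)\,d\sigma(x).$$
   Context: $\mathbb{S}^{d-1}$ is the unit sphere in $\mathbb{R}^d$ and $d\sigma$ its surface area measure. The angular derivatives are $D_{i,j}=x_i\partial_j-x_j\partial_i$; they act on a function $f$ on the sphere by applying $x_i\partial_j-x_j\partial_i$ to $F(y)=f(y/\|y\|)$ (or to any $C^1$ extension; the result does not depend on the extension) and restricting to $\mathbb{S}^{d-1}$. *)

(* Defs.v *)
From HB Require Import structures.
From mathcomp Require Import all_boot all_order all_algebra.
From mathcomp Require Import all_classical all_reals all_analysis.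
From mathcomp Require Import measurable_realfun.
Import Order.TTheory GRing.Theory Num.Theory.
Import numFieldNormedType.Exports.

Set Implicit Arguments.
Unset Strict Implicit.
Unset Printing Implicit Defensive.

Local Open Scope classical_set_scope.
Local Open Scope ring_scope.

(* The sigma-algebra on row vectors is the one generated by the coordinates;
   for T = R this is the Borel sigma-algebra of R^n. *)
Definition measure_rV_display : measure_display -> measure_display.
Proof. exact. Qed.

Section measurable_rV.
Context {disp : measure_display} {T : sigmaRingType disp}.
Variable n : nat.

Let coords : 'I_n -> 'rV[T]_n -> T := fun i x => x ord0 i.

Let rV_set0 : g_sigma_preimage coords set0.
Proof. exact: sigma_algebra0. Qed.

Let rV_setC A : g_sigma_preimage coords A -> g_sigma_preimage coords (~` A).
Proof. exact: sigma_algebraC. Qed.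

Let rV_bigcup (F : _^nat) : (forall i, g_sigma_preimage coords (F i)) ->
  g_sigma_preimage coords (\bigcup_i (F i)).
Proof. exact: sigma_algebra_bigcup. Qed.

HB.instance Definition _ := @isMeasurable.Build (measure_rV_display disp)
  'rV[T]_n (g_sigma_preimage coords) rV_set0 rV_setC rV_bigcup.

End measurable_rV.

Lemma measurable_coord disp (T : sigmaRingType disp) n (i : 'I_n) :
  measurable_fun [set: 'rV[T]_n] (fun x : 'rV[T]_n => x ord0 i).
Proof.
move=> _ Y mY; rewrite setTI; apply: sub_sigma_algebra => /=.
rewrite -bigcup_seq/=; exists i => /=; first by rewrite mem_index_enum.
by exists Y => //; rewrite setTI.
Qed.

Lemma measurable_fun_coordP d1 d2 (T1 : measurableType d1)
    (T2 : measurableType d2) n (f : T1 -> 'rV[T2]_n) :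
  (forall i, measurable_fun [set: T1] (fun t => f t ord0 i)) ->
  measurable_fun [set: T1] f.
Proof.
move=> mf _ A mA.
suff : g_sigma_preimage (fun i => (fun x : 'rV[T2]_n => x ord0 i) \o f)
    `<=` measurable.
  by apply; rewrite g_sigma_preimage_comp; exists A.
apply: smallest_sub; first exact: sigma_algebra_measurable.
case: n => [|n] in f mf A mA *; first by rewrite big_ord0.
rewrite -bigcup_mkord_ord; apply: bigcup_sub => i Ii.
by move=> B [C mC <-]; exact: mf.
Qed.

Section lebesgue_rV.
Local Open Scope ereal_scope.
Context {R : realType}.
Local Notation mR := (measurableTypeR R).

Definition cons_rV n (p : mR * 'rV[R]_n) : 'rV[R]_n.+1 :=
  \row_i oapp (p.2 ord0) p.1 (unlift ord0 i).

Definition uncons_rV n (x : 'rV[R]_n.+1) : mR * 'rV[R]_n :=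
  (x ord0 ord0, \row_i x ord0 (lift ord0 i)).

Lemma cons_rV0 n (p : mR * 'rV[R]_n) : cons_rV p ord0 ord0 = p.1.
Proof. by rewrite mxE unlift_none. Qed.

Lemma cons_rVS n (p : mR * 'rV[R]_n) (i : 'I_n) :
  cons_rV p ord0 (lift ord0 i) = p.2 ord0 i.
Proof. by rewrite mxE liftK. Qed.

Lemma cons_rVK n : cancel (@cons_rV n) (@uncons_rV n).
Proof.
move=> p; rewrite /uncons_rV cons_rV0 [RHS]surjective_pairing; congr pair.
by apply/rowP => i; rewrite mxE cons_rVS.
Qed.

Lemma uncons_rVK n : cancel (@uncons_rV n) (@cons_rV n).
Proof.
move=> x; apply/rowP => i; case: (unliftP ord0 i) => [j|] ->.
  by rewrite cons_rVS mxE.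
by rewrite cons_rV0.
Qed.

Lemma measurable_cons_rV n : measurable_fun setT (@cons_rV n).
Proof.
apply: measurable_fun_coordP => i; case: (unliftP ord0 i) => [j|] ->.
  under eq_fun do rewrite cons_rVS.
  exact: measurableT_comp (measurable_coord j) measurable_snd.
by under eq_fun do rewrite cons_rV0; exact: measurable_fst.
Qed.

Lemma measurable_uncons_rV n : measurable_fun setT (@uncons_rV n).
Proof.
apply: measurable_fun_pair; first exact: measurable_coord.
apply: measurable_fun_coordP => i.
under eq_fun do rewrite mxE.
exact: measurable_coord.
Qed.

Section cons_measure.
Variables (n : nat) (m : {sigma_finite_measure set 'rV[R]_n -> \bar R}).

(* The product of Lebesgue measure on R and m, transported to R^(n+1). *)
Definition cons_measure (A : set 'rV[R]_n.+1) : \bar R :=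
  (@lebesgue_measure R \x m) (@cons_rV n @^-1` A).

Let cons_measure0 : cons_measure set0 = 0.
Proof. by rewrite /cons_measure preimage_set0 measure0. Qed.

Let cons_measure_ge0 A : 0 <= cons_measure A.
Proof. exact: measure_ge0. Qed.

Let mpre (A : set 'rV[R]_n.+1) : measurable A -> measurable (@cons_rV n @^-1` A).
Proof.
by move=> mA; rewrite -[X in measurable X]setTI; exact: measurable_cons_rV.
Qed.

Let cons_measure_sigma_additive : semi_sigma_additive cons_measure.
Proof.
move=> F mF tF mUF; rewrite /cons_measure preimage_bigcup.
apply: measure_semi_sigma_additive.
- by move=> k; exact: mpre.
- apply/trivIsetP => /= i j _ _ ij; rewrite -preimage_setI.
  by move/trivIsetP : tF => /(_ _ _ _ _ ij) ->//; rewrite preimage_set0.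
- by rewrite -preimage_bigcup; exact: mpre.
Qed.

HB.instance Definition _ := isMeasure.Build _ _ _ cons_measure
  cons_measure0 cons_measure_ge0 cons_measure_sigma_additive.

Let cons_measure_sigma_finite : sigma_finite setT cons_measure.
Proof.
have /sigma_finiteP[F [UF ndF Foo]] := sigma_finiteT (@lebesgue_measure R).
have /sigma_finiteP[G [UG ndG Goo]] := sigma_finiteT m.
exists (fun k => @uncons_rV n @^-1` (F k `*` G k)).
  rewrite -preimage_bigcup (_ : \bigcup_k _ = setT) ?preimage_setT//.
  rewrite predeqE => -[x y]; split => // _.
  have : [set: mR] x by [].
  have : [set: 'rV[R]_n] y by [].
  rewrite UF UG => -[k _ Gky] [l _ Flx]; exists (maxn l k) => //; split => /=.
  - by move: x Flx; exact/subsetPset/ndF/leq_maxl.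
  - by move: y Gky; exact/subsetPset/ndG/leq_maxr.
move=> k; have [mFk Fkoo] := Foo k; have [mGk Gkoo] := Goo k; split.
  rewrite -[X in measurable X]setTI; apply: measurable_uncons_rV => //.
  exact: measurableX.
rewrite /cons_measure -comp_preimage (_ : _ \o _ = id); last first.
  by apply/funext => p /=; rewrite cons_rVK.
by rewrite preimage_id product_measure1E// lte_mul_pinfty// ge0_fin_numE.
Qed.

HB.instance Definition _ := Measure_isSigmaFinite.Build _ _ _ cons_measure
  cons_measure_sigma_finite.

End cons_measure.

Fixpoint lebesgue_rV n : {sigma_finite_measure set 'rV[R]_n -> \bar R} :=
  match n with
  | 0 => \d_(0%R : 'rV[R]_0)
  | k.+1 => cons_measure (lebesgue_rV k)
  end.

Lemma lebesgue_rV_box n (B : 'I_n -> set mR) : (forall i, measurable (B i)) ->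
  lebesgue_rV n [set x | forall i, B i (x ord0 i)] =
  \prod_(i < n) lebesgue_measure (B i).
Proof.
elim: n B => [|n IHn] B mB.
  rewrite big_ord0 /= diracE mem_set//; by move=> -[].
have mbox (C : 'I_n -> set mR) : (forall i, measurable (C i)) ->
    measurable [set x : 'rV[R]_n | forall i, C i (x ord0 i)].
  move=> mC; rewrite (_ : [set _ | _] =
      \big[setI/setT]_(i < n) [set x : 'rV[R]_n | C i (x ord0 i)]); last first.
    rewrite -bigcap_seq; apply/seteqP; split => x Cx i; first by move=> _; exact: Cx.
    by apply: (Cx i); rewrite /= mem_index_enum.
  apply: bigsetI_measurable => i _.
  rewrite -[X in measurable X]setTI.
  by apply: (measurable_coord i) => //; exact: mC.
rewrite big_ord_recl -IHn//.
rewrite -product_measure1E; [|exact: mB|by apply: (mbox (B \o lift ord0)) => i; exact: mB].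
rewrite /= /cons_measure; congr (_ _); apply/seteqP; split => -[x y] /= Bxy.
  split => /= [|i].
    by have := Bxy ord0; rewrite cons_rV0.
  by have := Bxy (lift ord0 i); rewrite cons_rVS.
move=> i; case: (unliftP ord0 i) => [k|] ->; last by rewrite cons_rV0; case: Bxy.
by rewrite cons_rVS; case: Bxy => _; exact.
Qed.

End lebesgue_rV.

Section sphere.
Context {R : realType} {d : nat}.
Implicit Types (x y : 'rV[R]_d) (A : set 'rV[R]_d) (f F : 'rV[R]_d -> R).

(* The library norm on row vectors is the sup norm. *)
Definition enorm x : R := Num.sqrt (\sum_i x ord0 i ^+ 2).

Definition sphere : set 'rV[R]_d := [set x | enorm x = 1].

Definition proj_sphere x : 'rV[R]_d := (enorm x)^-1 *: x.

Lemma measurable_enorm : measurable_fun setT enorm.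
Proof.
apply: (@measurableT_comp _ _ _ _ _ _ (@Num.sqrt R)).
  by apply: continuous_measurable_fun; exact: sqrt_continuous.
apply: measurable_sum => i.
by apply: measurable_funX; exact: measurable_coord.
Qed.

Lemma measurable_proj_sphere : measurable_fun setT proj_sphere.
Proof.
apply: measurable_fun_coordP => i; under eq_fun do rewrite mxE.
apply: measurable_funM; last exact: measurable_coord.
rewrite (_ : (fun=> _) = (fun a : R => a `^ (-1)) \o enorm); last first.
  by apply/funext => x /=; rewrite powR_inv1// sqrtr_ge0.
exact: measurableT_comp (measurable_powR _) measurable_enorm.
Qed.

(* The part in the closed unit ball of the cone spanned by A (without apex). *)
Definition solid_cone A : set 'rV[R]_d :=
  [set y | 0 < enorm y <= 1 /\ A (proj_sphere y)].

Lemma measurable_solid_cone A : measurable A -> measurable (solid_cone A).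
Proof.
move=> mA; rewrite (_ : solid_cone A =
    enorm @^-1` `]0, 1] `&` proj_sphere @^-1` A); last first.
  by apply/seteqP; split => y /=; rewrite in_itv.
apply: measurableI; rewrite -[X in measurable X]setTI.
  by apply: measurable_enorm => //; exact: measurable_itv.
exact: measurable_proj_sphere.
Qed.

(* Surface area measure of the unit sphere, as a measure on R^d carried by the
   sphere: in polar coordinates dy = r^(d-1) dr dsigma, so that the volume of
   the solid cone over A is sigma(A) / d. *)
Definition surface_measure A : \bar R :=
  (d%:R%:E * lebesgue_rV d (solid_cone A))%E.

Let surface_measure0 : surface_measure set0 = 0%E.
Proof.
rewrite /surface_measure (_ : solid_cone set0 = set0) ?measure0 ?mule0//.
by rewrite -subset0 => y [].
Qed.

Let surface_measure_ge0 A : (0 <= surface_measure A)%E.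
Proof. by rewrite mule_ge0// lee_fin. Qed.

Let surface_measure_sigma_additive : semi_sigma_additive surface_measure.
Proof.
move=> F mF tF mUF.
have cF : solid_cone (\bigcup_n F n) = \bigcup_n solid_cone (F n).
  apply/seteqP; split => y /=; first by move=> [y1 [n _ Fn]]; exists n.
  by move=> [n _ [y1 Fn]]; split => //; exists n.
have -> : (fun n => \sum_(0 <= i < n) surface_measure (F i))%E =
    (fun n => d%:R%:E * \sum_(0 <= i < n) lebesgue_rV d (solid_cone (F i)))%E.
  by apply/funext => n; rewrite ge0_sume_distrr.
rewrite /surface_measure; apply: cvgeZl => //; rewrite cF.
apply: measure_semi_sigma_additive.
- by move=> n; exact: measurable_solid_cone.
- apply/trivIsetP => i j _ _ ij.
  rewrite -subset0 => y [[_ Fi] [_ Fj]].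
  move/trivIsetP : tF => /(_ _ _ Logic.I Logic.I ij).
  by rewrite -subset0 => /(_ (proj_sphere y)); apply.
- by rewrite -cF; exact: measurable_solid_cone.
Qed.

HB.instance Definition _ := isMeasure.Build _ _ _ surface_measure
  surface_measure0 surface_measure_ge0 surface_measure_sigma_additive.

Definition basis_vec (i : 'I_d) : 'rV[R]_d := delta_mx ord0 i.

(* Only the values of f on the sphere matter. *)
Definition radial_ext f : 'rV[R]_d -> R := f \o proj_sphere.

Definition C1_on (U : set 'rV[R]_d) F :=
  forall x, U x -> differentiable F x /\
    forall v : 'rV[R]_d, {for x, continuous (fun y => 'D_v F y)}.

(* f is C^1 on the sphere iff its extension homogeneous of degree 0 is C^1 on
   R^d minus the origin. *)
Definition C1_sphere f := C1_on [set y | y != 0] (radial_ext f).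

Definition angular_derive (i j : 'I_d) F x : R :=
  x ord0 i * 'D_(basis_vec j) F x - x ord0 j * 'D_(basis_vec i) F x.

Definition sphere_derive (i j : 'I_d) f x : R :=
  angular_derive i j (radial_ext f) x.

End sphere.

Arguments sphere R d : clear implicits.
Arguments surface_measure R d : clear implicits.

(* Main.v *)
(* The surface measure is invariant under rotations of the (i, j)-plane: such a
   rotation is a product of three shears, each of which preserves Lebesgue measure
   by Fubini's theorem, and it preserves the Euclidean norm. Hence, for H of class
   C^1 off the origin, the integral of H over the rotated sphere does not depend on
   the angle t; differentiating at t = 0 under the integral sign shows that the
   integral of D_(i,j) H vanishes. The theorem is the case H = f g. *)

Require Import Defs.
From mathcomp Require Import all_boot all_order all_algebra.
From mathcomp Require Import all_classical all_reals all_analysis.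
From mathcomp Require Import measurable_realfun ring.
Import Order.TTheory GRing.Theory Num.Theory.
Import numFieldNormedType.Exports.

Local Open Scope classical_set_scope.
Local Open Scope ring_scope.

(** * Lebesgue measure on R^n: translations, Borel sets and shears *)

Lemma lebesgue_measure_translate (R : realType) (a : R) (A : set R) :
  measurable A ->
  lebesgue_measure ((fun x => x + a) @^-1` A) = lebesgue_measure A.
Proof.
have mT : measurable_fun setT ((fun x => x + a) : R -> measurableTypeR R).
  exact: measurable_funD.
move=> mA; rewrite -[LHS]/(pushforward lebesgue_measure
  ((fun x => x + a) : R -> measurableTypeR R) A).
(* By uniqueness it suffices to compare the two measures on half-open intervals. *)
apply/esym/lebesgue_measure_unique => //= _ [[u v]] _ <-.
rewrite /pushforward /=.
rewrite (_ : _ @^-1` _ = `]u - a, v - a]%classic); last first.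
  by apply/seteqP; split => x /=; rewrite !in_itv /= ltrBlDr lerBrDr.
rewrite !lebesgue_measure_itv /= !lte_fin ltrD2r.
by case: ifP => // _; rewrite -!EFinD; congr (_%:E); ring.
Qed.

(** Links the topology to the sigma-algebra generated by the coordinates: the countably many open
    cubes with rational centre and radius 1/(N+1) that lie in [U] cover [U]. *)
Lemma open_measurable_rV (R : realType) n (U : set 'rV[R]_n) :
  open U -> measurable U.
Proof.
move=> oU.
pose box (c : 'rV[rat]_n * nat) : set 'rV[R]_n :=
  [set x | forall k, `|x ord0 k - ratr (c.1 ord0 k)| < c.2.+1%:R^-1].
have mbox c : measurable (box c).
  rewrite (_ : box c = \bigcap_(k in [set: 'I_n])
     ((fun x : 'rV[R]_n => x ord0 k) @^-1`
        [set t | `|t - ratr (c.1 ord0 k)| < c.2.+1%:R^-1])); last first.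
    by apply/seteqP; split => x /= h k; [move=> _; exact: h|exact: (h k)].
  apply: fin_bigcap_measurable => // k _.
  rewrite -[X in measurable X]setTI; apply: (measurable_coord k) => //.
  apply: open_measurable.
  rewrite (_ : [set _ | _] = ball (ratr (c.1 ord0 k) : R) c.2.+1%:R^-1).
    exact: ball_open.
  by apply/seteqP; split => t /=; rewrite -ball_normE /= distrC.
pose F (c : 'rV[rat]_n * nat) := if `[< box c `<=` U >] then box c else set0.
rewrite (_ : U = \bigcup_c F c).
  apply: countable_bigcupT_measurable => // c.
  by rewrite /F; case: ifP.
apply/seteqP; split => [x Ux|x [c _]]; last first.
  by rewrite /F; case: ifPn => // /asboolP h /h.
have /nbhs_ballP[e /= e0 eU] := open_nbhs_nbhs (conj oU Ux).
(* A cube of radius below [e / 2] that contains [x] lies in the sup-norm ball of radius [e] about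
   [x]. *)
have [N Ne] : exists N : nat, N.+1%:R^-1 < e / 2.
  have [N _ h] := near_infty_natSinv_lt (PosNum (divr_gt0 e0 (ltr0n _ 2))).
  by exists N; exact: (h N (leqnn N)).
have /choice[q hq] : forall k : 'I_n, exists q : rat,
    `|x ord0 k - ratr q| < N.+1%:R^-1.
  move=> k; have N0 : 0 < N.+1%:R^-1 :> R by rewrite invr_gt0.
  have [q] := @rat_in_itvoo R (x ord0 k - N.+1%:R^-1) (x ord0 k + N.+1%:R^-1)
    ltac:(by rewrite ltrD2l gtrN).
  rewrite in_itv /= => /andP[q1 q2]; exists q.
  by rewrite distrC ltr_distl q1 q2.
exists (\row_k q k, N) => //.
have xb : box (\row_k q k, N) x by move=> k /=; rewrite mxE.
rewrite /F; case: ifPn => // /asboolP; case => y yb.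
apply: eU; split => // i0 k; rewrite (ord1 i0) /ball /= /ball_ /=.
have := xb k; have := yb k; rewrite /= => h1 h2.
apply: le_lt_trans (ler_distD (ratr ((\row_k0 q k0) ord0 k)) _ _) _.
by rewrite (splitr e) ltrD// ?(lt_trans _ Ne)// distrC.
Qed.

(** With continuity only at the points of [D], the preimage of an open set may fail to be open, but
    on [D] it coincides with its interior. *)
Lemma measurable_fun_continuous_at (R : realType) n (D : set 'rV[R]_n)
    (h : 'rV[R]_n -> R) :
  measurable D -> (forall x, D x -> {for x, continuous h}) ->
  measurable_fun D h.
Proof.
move=> mD ch; apply: (measurability _ (RGenOpens.measurableE R)).
move=> _ [_ [a [b ->]] <-].
set V := `]a, b[%classic; have oV : open V by exact: itv_open.
rewrite (_ : D `&` h @^-1` V = D `&` (h @^-1` V)^°).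
  by apply: measurableI => //; apply: open_measurable_rV; exact: open_interior.
apply/seteqP; split => x [Dx Vx]; split => //; last exact: nbhs_singleton Vx.
by apply: (ch x Dx); exact: open_nbhs_nbhs.
Qed.

Lemma measurable_add_basis_vec (R : realType) n (i : 'I_n) (h : 'rV[R]_n -> R) :
  measurable_fun setT h ->
  measurable_fun setT (fun x : 'rV[R]_n => x + h x *: basis_vec i).
Proof.
move=> mh; apply: measurable_fun_coordP => k.
under eq_fun do rewrite !mxE.
apply: measurable_funD; first exact: measurable_coord.
exact: measurable_funM.
Qed.

(** On each line parallel to the [i]-th axis [h] is constant, so the map translates that line. The
    induction follows the recursion of [lebesgue_rV], which splits off coordinate 0. *)
Lemma lebesgue_rV_shear (R : realType) n (i : 'I_n) (h : 'rV[R]_n -> R)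
    (A : set 'rV[R]_n) :
  measurable_fun setT h -> (forall x t, h (x + t *: basis_vec i) = h x) ->
  measurable A ->
  lebesgue_rV n ((fun x : 'rV[R]_n => x + h x *: basis_vec i) @^-1` A) = lebesgue_rV n A.
Proof.
elim: n i h A => [[]//|n IHn] i h A mh hi mA.
pose T (x : 'rV[R]_n.+1) := x + h x *: basis_vec i; rewrite -/T.
have mT : measurable_fun setT T by exact: measurable_add_basis_vec.
have mTA : measurable (T @^-1` A).
  by rewrite -[X in measurable X]setTI; exact: mT.
have mc B : measurable B -> measurable (@cons_rV R n @^-1` B).
  by move=> mB; rewrite -[X in measurable X]setTI; exact: measurable_cons_rV.
rewrite /= /cons_measure.
(* For i = 0, integrating first over coordinate 0 turns the shear into translations
   of the line; otherwise it restricts to a shear on each slice x_0 = const. *)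
case: (unliftP ord0 i) => [k|] ik; last first.
  (* Evaluating [h] with coordinate 0 set to 0 shows that the translation length depends on [p.2]
     alone. *)
  have cT p : T (cons_rV p) = cons_rV (p.1 + h (cons_rV (0, p.2)), p.2).
    have -> : h (cons_rV (0, p.2)) = h (cons_rV p).
      rewrite -(hi (cons_rV (0, p.2)) p.1); congr h.
      apply/rowP => l; case: (unliftP ord0 l) => [l'|] ->.
        by rewrite !mxE !liftK /= ?ik ?eqxx ?lift_eqF mulr0 addr0.
      by rewrite !mxE !unlift_none /= ?ik !eqxx mulr1 add0r.
    apply/rowP => l; case: (unliftP ord0 l) => [l'|] ->.
      by rewrite !mxE !liftK /= ?ik ?eqxx ?lift_eqF mulr0 addr0.
    by rewrite !mxE !unlift_none /= ?ik !eqxx mulr1.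
  (* On both sides the order of integration is exchanged, so that the integrand becomes the Lebesgue
     measure of a section along coordinate 0. *)
  rewrite (product_measure_unique
    (m' := (lebesgue_measure \x^ lebesgue_rV n)%E))//; last 2 first.
  - by move=> *; exact: product_measure2E.
  - exact: mc.
  rewrite (product_measure_unique
    (m' := (lebesgue_measure \x^ lebesgue_rV n)%E))//; last 2 first.
  - by move=> *; exact: product_measure2E.
  - exact: mc.
  apply: eq_integral => y _ /=.
  rewrite -[RHS](lebesgue_measure_translate _ (h (cons_rV (0, y)))); last first.
    exact: measurable_ysection (mc _ mA).
  congr lebesgue_measure; apply/seteqP; split=> x /=;
    by rewrite /ysection /= !inE /= cT.
apply: eq_integral => x _ /=.
pose hx y := h (cons_rV (x, y)).
have cT y : T (cons_rV (x, y)) = cons_rV (x, y + hx y *: basis_vec k).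
  apply/rowP => l; case: (unliftP ord0 l) => [l'|] ->.
    by rewrite !mxE !liftK /= ?ik !mxE (inj_eq (@lift_inj _ ord0)).
  by rewrite !mxE !unlift_none /= ?ik /= mulr0 addr0.
rewrite -[RHS](IHn k hx); last 3 first.
- apply: measurableT_comp => //.
  by apply: measurableT_comp; [exact: measurable_cons_rV|exact: pair1_measurable].
- move=> y t; rewrite /hx -(hi (cons_rV (x, y)) t); congr h.
  apply/rowP => l; case: (unliftP ord0 l) => [l'|] ->.
    by rewrite !mxE !liftK /= ?ik !mxE (inj_eq (@lift_inj _ ord0)).
  by rewrite !mxE !unlift_none /= ?ik /= mulr0 addr0.
- exact: measurable_xsection (mc _ mA).
congr (lebesgue_rV n _); apply/seteqP; split=> y /=;
  by rewrite /xsection /= !inE /= cT.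
Qed.

(** * Rotations of a coordinate plane and invariance of the surface measure *)

(** Here [c] and [s] stand for the cosine and sine of the angle. Writing the map as the identity
    plus multiples of two vectors fixed by [x] makes it easy to differentiate in the angle. *)
Definition rotation {R : realType} {d} (i j : 'I_d) (c s : R) (x : 'rV[R]_d) :
  'rV[R]_d :=
  x + (c - 1) *: (x ord0 i *: basis_vec i + x ord0 j *: basis_vec j)
    + s *: (x ord0 i *: basis_vec j - x ord0 j *: basis_vec i).

Section rotation.
Context {R : realType} {d : nat} {i j : 'I_d} {c s : R}.
Hypotheses (ij : i != j) (cs1 : c ^+ 2 + s ^+ 2 = 1).

Lemma rotation_fst x : rotation i j c s x ord0 i = c * x ord0 i - s * x ord0 j.
Proof. by rewrite !mxE !eqxx (negbTE ij) /=; ring. Qed.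

Lemma rotation_snd x : rotation i j c s x ord0 j = s * x ord0 i + c * x ord0 j.
Proof. by rewrite !mxE !eqxx (eq_sym j) (negbTE ij) /=; ring. Qed.

Lemma rotation_other x k : k != i -> k != j -> rotation i j c s x ord0 k = x ord0 k.
Proof. by move=> ki kj; rewrite !mxE (negbTE ki) (negbTE kj) /=; ring. Qed.

Lemma enorm_rotation x : enorm (rotation i j c s x) = enorm x.
Proof.
have ji : j != i by rewrite eq_sym.
rewrite /enorm; congr Num.sqrt.
rewrite (bigD1 i)// (bigD1 j)//= [RHS](bigD1 i)// [in RHS](bigD1 j)//=.
rewrite !addrA rotation_fst rotation_snd; congr (_ + _).
  transitivity ((c ^+ 2 + s ^+ 2) * (x ord0 i ^+ 2 + x ord0 j ^+ 2)); first by ring.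
  by rewrite cs1 mul1r.
by apply: eq_bigr => k /andP[ki kj]; rewrite rotation_other.
Qed.

Lemma rotationZ a x : rotation i j c s (a *: x) = a *: rotation i j c s x.
Proof. by apply/rowP => k; rewrite !mxE; ring. Qed.

Lemma proj_sphere_rotation x :
  proj_sphere (rotation i j c s x) = rotation i j c s (proj_sphere x).
Proof. by rewrite /proj_sphere enorm_rotation rotationZ. Qed.

Lemma preimage_rotation_sphere :
  rotation i j c s @^-1` sphere R d = sphere R d.
Proof. by apply/seteqP; split => x; rewrite /sphere /= enorm_rotation. Qed.

Lemma measurable_rotation : measurable_fun setT (rotation i j c s).
Proof.
apply: measurable_fun_coordP => k; under eq_fun do rewrite !mxE.
have mc l : measurable_fun setT (fun x : 'rV[R]_d => x ord0 l).
  exact: measurable_coord.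
apply: measurable_funD; first apply: measurable_funD => //.
  by apply: measurable_funM => //; apply: measurable_funD; apply: measurable_funM.
by apply: measurable_funM => //; apply: measurable_funB; apply: measurable_funM.
Qed.

(** The rotation factors as [T1 \o T2 \o T1], where [T1] adds [a] times coordinate [j] to coordinate
    [i] and [T2] adds [s] times coordinate [i] to coordinate [j]. The hypothesis on [s] allows the
    division that defines [a]. *)
Lemma lebesgue_rV_rotation (A : set 'rV[R]_d) : s != 0 -> measurable A ->
  lebesgue_rV d (rotation i j c s @^-1` A) = lebesgue_rV d A.
Proof.
move=> s0 mA; have ji : j != i by rewrite eq_sym.
(* a = - tan (t / 2) when c = cos t and s = sin t *)
pose a := (c - 1) / s.
pose h1 (x : 'rV[R]_d) := a * x ord0 j; pose h2 (x : 'rV[R]_d) := s * x ord0 i.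
pose T1 (x : 'rV[R]_d) := x + h1 x *: basis_vec i.
pose T2 (x : 'rV[R]_d) := x + h2 x *: basis_vec j.
have mh1 : measurable_fun setT h1.
  by apply: measurable_funM => //; exact: measurable_coord.
have mh2 : measurable_fun setT h2.
  by apply: measurable_funM => //; exact: measurable_coord.
have mT1 B : measurable B -> measurable (T1 @^-1` B).
  by move=> mB; rewrite -[X in measurable X]setTI; exact: measurable_add_basis_vec.
have mT2 B : measurable B -> measurable (T2 @^-1` B).
  by move=> mB; rewrite -[X in measurable X]setTI; exact: measurable_add_basis_vec.
have T1E B : measurable B -> lebesgue_rV d (T1 @^-1` B) = lebesgue_rV d B.
  apply: lebesgue_rV_shear => // x t.
  by rewrite /h1 !mxE (negbTE ji) mulr0 addr0.
have T2E B : measurable B -> lebesgue_rV d (T2 @^-1` B) = lebesgue_rV d B.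
  apply: lebesgue_rV_shear => // x t.
  by rewrite /h2 !mxE (negbTE ij) mulr0 addr0.
(* In the matrix of the product of shears the diagonal entries are 1 + a s = c, and the entry in row
   [i], column [j] is 2 a + a^2 s = - s. *)
have as1 : a * s = c - 1 by rewrite /a divfK.
have asa : a * s * a = - s - 2 * a.
  have s2 : s ^+ 2 = 1 - c ^+ 2 by rewrite -cs1; ring.
  apply: (mulIf s0); transitivity ((a * s) ^+ 2); first by ring.
  transitivity (- s ^+ 2 - 2 * (a * s)); last by ring.
  by rewrite as1 s2; ring.
(* The factorization read in one coordinate [k]: [x0] is the entry of x there, and [di], [dj] are
   the entries of the two basis vectors. *)
have key x0 xi xj di dj :
    x0 + (c - 1) * (xi * di + xj * dj) + s * (xi * dj - xj * di) =
    x0 + a * xj * di + s * (xi + a * xj) * dj +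
      a * (xj + s * (xi + a * xj)) * di.
  transitivity (x0 + (a * s) * (xi * di + xj * dj) + s * xi * dj +
    (2 * a + (- s - 2 * a)) * xj * di); first by rewrite as1; ring.
  by rewrite -asa; ring.
have -> : rotation i j c s = T1 \o T2 \o T1.
  apply/funext => x; apply/rowP => k /=; rewrite /T1 /T2 /h1 /h2.
  rewrite !mxE !eqxx ?(negbTE ij) ?(negbTE ji) /= !mulr1 !mulr0 !addr0.
  exact: key.
rewrite -[_ @^-1` A]/(T1 @^-1` (T2 @^-1` (T1 @^-1` A))).
by rewrite (T1E _ (mT2 _ (mT1 _ mA))) (T2E _ (mT1 _ mA)) (T1E _ mA).
Qed.

(** A rotation preserves [enorm] and commutes with [proj_sphere], so forming the solid cone commutes
    with taking preimages. *)
Lemma surface_measure_rotation (A : set 'rV[R]_d) : s != 0 -> measurable A ->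
  surface_measure R d (rotation i j c s @^-1` A) = surface_measure R d A.
Proof.
move=> s0 mA; rewrite /surface_measure; congr (_ * _)%E.
rewrite -(lebesgue_rV_rotation _ s0 (measurable_solid_cone mA)).
congr (lebesgue_rV d _); apply/seteqP; split=> x; rewrite /solid_cone /=;
  by rewrite enorm_rotation proj_sphere_rotation.
Qed.

End rotation.

(** * Integration over the sphere: finiteness, rotated integrals, compactness *)

Lemma measurable_sphere (R : realType) d : measurable (sphere R d).
Proof.
rewrite (_ : sphere R d = enorm @^-1` [set 1])//.
rewrite -[X in measurable X]setTI; exact: measurable_enorm.
Qed.

Lemma ler_coord_enorm {R : realType} {d} (x : 'rV[R]_d) k :
  `|x ord0 k| <= enorm x.
Proof.
rewrite /enorm -sqrtr_sqr ler_wsqrtr// (bigD1 k)//= lerDl.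
by apply: sumr_ge0 => l _; exact: sqr_ge0.
Qed.

(** The solid cones all lie in the cube [-1, 1]^d, whose volume is finite. *)
Lemma surface_measure_finite (R : realType) d :
  (surface_measure R d [set: _] < +oo)%E.
Proof.
rewrite /surface_measure lte_mul_pinfty ?lee_fin//.
apply: (@le_lt_trans _ _ (lebesgue_rV d
  [set x : 'rV[R]_d | forall k, `[-1, 1]%classic (x ord0 k)])).
  apply: le_measure; rewrite ?inE.
  - exact: measurable_solid_cone.
  - rewrite (_ : [set x | _] = \bigcap_(k in [set: 'I_d])
       ((fun x : 'rV[R]_d => x ord0 k) @^-1` `[-1, 1])); last first.
      by apply/seteqP; split => x /= h k; [move=> _; exact: h|exact: (h k)].
    apply: fin_bigcap_measurable => // k _.
    rewrite -[X in measurable X]setTI; apply: (measurable_coord k) => //.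
  - move=> x [/andP[_ x1] _] k /=.
    by rewrite in_itv /= -ler_norml (le_trans (ler_coord_enorm x k)).
rewrite (lebesgue_rV_box (B := fun=> `[-1, 1]%classic))//.
under eq_bigr do rewrite lebesgue_measure_itv /=.
by rewrite lte_fin (lt_trans (ltrN10 R) ltr01) -EFinD prodEFin ltry.
Qed.

Lemma integral_rotation (R : realType) d (i j : 'I_d) (c s : R)
    (h : 'rV[R]_d -> R) : i != j -> c ^+ 2 + s ^+ 2 = 1 -> s != 0 ->
  measurable_fun (sphere R d) h ->
  (surface_measure R d).-integrable (sphere R d)
    (fun x => (h (rotation i j c s x))%:E) ->
  (\int[surface_measure R d]_(x in sphere R d) (h (rotation i j c s x))%:E =
   \int[surface_measure R d]_(x in sphere R d) (h x)%:E)%E.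
Proof.
move=> ij cs1 s0 mh ih.
have mS := @measurable_sphere R d.
(* Extension by zero turns measurability on the sphere into measurability on the whole space, as the
   pushforward formula requires. *)
pose h' := (EFin \o h) \_ (sphere R d).
have mh' : measurable_fun setT h'.
  by apply/(measurable_restrictT _ mS); exact/measurable_EFinP.
transitivity (\int[surface_measure R d]_(x in sphere R d)
    (h' \o rotation i j c s) x)%E.
  apply: eq_integral => x; rewrite inE => Sx /=.
  by rewrite /h' patchE mem_set// /sphere /= enorm_rotation.
transitivity (\int[pushforward (surface_measure R d) (rotation i j c s)]_(x in
    sphere R d) h' x)%E.
  rewrite integral_pushforward ?preimage_rotation_sphere//.
  - exact: measurable_rotation.
  - apply: eq_integrable ih => // x; rewrite inE => Sx /=.
    by rewrite /h' patchE mem_set// /sphere /= enorm_rotation.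
transitivity (\int[surface_measure R d]_(x in sphere R d) h' x)%E.
  apply: eq_measure_integral => [|mr A mA _]; first exact: measurable_rotation.
  exact: surface_measure_rotation.
by apply: eq_integral => x; rewrite /h' patchE => ->.
Qed.

Lemma continuous_enorm (R : realType) d : continuous (@enorm R d).
Proof.
move=> x; apply: (@continuous_comp _ _ _ (fun y : 'rV[R]_d => \sum_k y ord0 k ^+ 2)
  (@Num.sqrt R)); last exact: sqrt_continuous.
apply: continuous_big => [|k _ y]; first exact: add_continuous.
apply: (@continuous_comp _ _ _ (fun z : 'rV[R]_d => z ord0 k) (@GRing.exp R ^~ 2%N)).
  exact: coord_continuous.
exact: exprn_continuous.
Qed.

Lemma compact_sphere (R : realType) d : compact (sphere R d).
Proof.
apply: bounded_closed_compact; last first.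
  rewrite (_ : sphere R d = enorm @^-1` [set 1])//.
  apply: closed_comp; last exact: closed_eq.
  by move=> x _; exact: continuous_enorm.
exists 1; split; first exact: num_real.
move=> M M1 x Sx; apply: le_trans (ltW M1).
rewrite [leLHS]/Num.norm /= mx_normrE; apply/bigmax_leP; split => // -[k l] _ /=.
by rewrite (ord1 k) -Sx ler_coord_enorm.
Qed.

Lemma bounded_on_sphere (R : realType) d (h : 'rV[R]_d -> R) :
  (forall x, sphere R d x -> {for x, continuous h}) ->
  exists M : R, forall x, sphere R d x -> `|h x| <= M.
Proof.
move=> ch.
have : bounded_set (h @` sphere R d).
  apply/compact_bounded/continuous_compact; last exact: compact_sphere.
  by apply: continuous_in_subspaceT => x; rewrite inE; exact: ch.
move=> [M [_ hM]]; exists (`|M| + 1) => x Sx.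
apply: (hM (`|M| + 1)); last by exists x.
by rewrite (le_lt_trans (ler_norm M))// ltrDl.
Qed.

(** Compactness of the sphere bounds [h], and the surface measure is finite. *)
Lemma integrable_continuous_sphere (R : realType) d (h : 'rV[R]_d -> R) :
  (forall x, sphere R d x -> {for x, continuous h}) ->
  (surface_measure R d).-integrable (sphere R d) (EFin \o h).
Proof.
move=> ch; have mS := @measurable_sphere R d.
apply: measurable_bounded_integrable => //.
- apply: le_lt_trans (surface_measure_finite R d).
  by apply: le_measure; rewrite ?inE.
- exact: measurable_fun_continuous_at.
- have [M hM] := bounded_on_sphere _ _ _ ch.
  exists M; split; first exact: num_real.
  by move=> N MN x Sx; apply: le_trans (hM x Sx) (ltW MN).
Qed.

Lemma sphere_neq0 {R : realType} {d} {x : 'rV[R]_d} : sphere R d x -> x != 0.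
Proof.
rewrite /sphere /= => /eqP; apply: contraTneq => ->.
rewrite /enorm big1 ?sqrtr0 1?eq_sym ?oner_eq0// => k _.
by rewrite mxE expr0n.
Qed.

(** * Differentiation along rotations and under the integral sign *)

(** Chain rule: the orbit passes through y with velocity y_i e_j - y_j e_i, the direction in which
    D_(i,j) differentiates. All [t] are covered, not just 0, because the mean value theorem is
    applied along the orbit later. *)
Lemma is_derive_rotation (R : realType) d (i j : 'I_d) (H : 'rV[R]_d -> R) x t :
  i != j ->
  differentiable H (rotation i j (cos t) (sin t) x) ->
  is_derive t 1 (fun u => H (rotation i j (cos u) (sin u) x))
    (angular_derive i j H (rotation i j (cos t) (sin t) x)).
Proof.
move=> ij dH.
pose v := x ord0 i *: basis_vec i + x ord0 j *: basis_vec j.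
pose w := x ord0 i *: basis_vec j - x ord0 j *: basis_vec i.
pose k1 (u : R) := cos u - 1.
have dk1 : is_derive t 1 k1 (- sin t).
  by apply: is_derive_eq; rewrite subr0.
have dsin : is_derive t 1 (@sin R) (cos t) by exact: is_derive_sin.
have diffk1 : differentiable k1 t by apply/derivable1_diffP; exact: ex_derive.
have diffsin : differentiable (@sin R) t by apply/derivable1_diffP; exact: ex_derive.
pose g u := rotation i j (cos u) (sin u) x.
have gE : g = cst x + (fun u => k1 u *: v) + (fun u => sin u *: w) by [].
have dv : is_diff t (fun u => k1 u *: v) (fun u => 'd k1 t u *: v).
  exact: DiffDef (differentiableZl v diffk1) (diffZl v diffk1).
have dw : is_diff t (fun u => sin u *: w) (fun u => 'd (@sin R) t u *: w).
  exact: DiffDef (differentiableZl w diffsin) (diffZl w diffsin).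
have dg : is_diff t g
    (0 + (fun u => 'd k1 t u *: v) + (fun u => 'd (@sin R) t u *: w)).
  rewrite gE; exact: (is_diffD (is_diffD (is_diff_cst _ t) dv) dw).
have g1 : 'd g t 1 = g t ord0 i *: basis_vec j - g t ord0 j *: basis_vec i.
  rewrite diff_val /= !fctE -!deriveE// !derive_val add0r.
  rewrite /g rotation_fst// rotation_snd// /v /w.
  by apply/rowP => k; rewrite !mxE; ring.
have dgt : differentiable g t by case: dg.
have dHg : differentiable (H \o g) t by exact: differentiable_comp.
apply: DeriveDef; first exact: diff_derivable.
rewrite deriveE// -[fun _ => _]/(H \o g) (diff_comp dgt dH) /=.
by rewrite g1 linearB !linearZ /= scalerN /angular_derive !deriveE.
Qed.

Lemma rotation0 {R : realType} {d} (i j : 'I_d) (x : 'rV[R]_d) :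
  rotation i j 1 0 x = x.
Proof. by rewrite /rotation subrr !scale0r !addr0. Qed.

Lemma continuous_rotation {R : realType} {d} (i j : 'I_d) (c s : R) :
  continuous (rotation i j c s).
Proof.
move=> x; apply: differentiable_continuous.
have dcoord k l :
    differentiable (fun y : 'rV[R]_d => y ord0 k *: (basis_vec l : 'rV[R]_d)) x.
  by apply: differentiableZl; exact: differentiable_coord.
apply: differentiableD; first apply: differentiableD => //.
  by apply: differentiableZ; exact: differentiableD.
by apply: differentiableZ; exact: differentiableB.
Qed.

(** [D] represents D_(i,j) H on the sphere only, which leaves room to supply it in Leibniz form when
    [H] is a product. *)
Lemma integral_angular_derive (R : realType) d (i j : 'I_d) (H D : 'rV[R]_d -> R) :
  i != j -> (forall x, x != 0 -> differentiable H x) ->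
  (forall x, sphere R d x -> {for x, continuous D}) ->
  (forall x, sphere R d x -> D x = angular_derive i j H x) ->
  (\int[surface_measure R d]_(x in sphere R d) (D x)%:E = 0)%E.
Proof.
move=> ij dH cD DE.
have mS := @measurable_sphere R d.
pose rot t (x : 'rV[R]_d) := rotation i j (cos t) (sin t) x.
have Srot t x : sphere R d x -> sphere R d (rot t x).
  by rewrite /sphere /= enorm_rotation// cos2Dsin2.
have rot0 x : rot 0 x = x by rewrite /rot cos0 sin0 rotation0.
have cH x : sphere R d x -> {for x, continuous H}.
  by move=> /sphere_neq0 /dH; exact: differentiable_continuous.
have cHrot t x : sphere R d x -> {for x, continuous (H \o rot t)}.
  move=> Sx; apply: continuous_comp; first exact: continuous_rotation.
  exact/cH/Srot.
have dphi x (t : R) : sphere R d x ->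
    is_derive t 1 (fun u : R => H (rot u x)) (D (rot t x)).
  move=> Sx; rewrite DE; last exact: Srot.
  by apply: is_derive_rotation => //; apply/dH/sphere_neq0/Srot.
have [M DM] := bounded_on_sphere _ _ _ cD.
(* Difference quotients at the angles 1/(n+1); a sequence of angles is what dominated convergence
   takes. Rotation invariance makes each of them integrate to 0. *)
pose q n x := (@harmonic R n)^-1 * (H (rot (harmonic n) x) - H x).
have cq n x : sphere R d x -> {for x, continuous (q n)}.
  move=> Sx; apply: continuousM; first exact: cst_continuous.
  by apply: continuousB; [exact: cHrot|exact: cH].
have iH := integrable_continuous_sphere _ _ _ cH.
have iHrot n := integrable_continuous_sphere _ _ _ (cHrot (harmonic n)).
have q0 n : (\int[surface_measure R d]_(x in sphere R d) (q n x)%:E = 0)%E.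
  under eq_integral do rewrite EFinM EFinB.
  rewrite integralZl//=; last exact: (integrableB mS (iHrot n) iH).
  rewrite (integralB mS (iHrot n) iH) /= integral_rotation//.
  - by rewrite subee ?mule0// integrable_fin_num.
  - exact: cos2Dsin2.
  (* The angle satisfies 0 < 1/(n+1) <= 1 < 2 <= pi, so its sine is nonzero. *)
  - rewrite gt_eqF// sin_gt0_pi// harmonic_gt0/= (lt_le_trans _ (pi_ge2 R))//.
    by rewrite (@le_lt_trans _ _ 1) ?ltr1n// invf_le1// ler1n.
  - exact: measurable_fun_continuous_at.
  - exact: iHrot.
have mq n : measurable_fun (sphere R d) (fun x => (q n x)%:E).
  by apply/measurable_EFinP; apply: measurable_fun_continuous_at => // x; exact: cq.
have mD : measurable_fun (sphere R d) (fun x => (D x)%:E).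
  by apply/measurable_EFinP; exact: measurable_fun_continuous_at.
have qD : {ae surface_measure R d, forall x, sphere R d x ->
    (q n x)%:E @[n --> \oo] --> (D x)%:E}.
  apply: aeW => x Sx; apply: cvg_EFin; first exact: nearW.
  have [dx Ex] := dphi x 0 Sx.
  pose phi (u : R) := H (rot u x).
  have quot : h^-1 *: ((phi \o shift 0) (h *: 1) - phi 0) @[h --> (0 : R)^'] --> D x.
    by rewrite -[x in D x]rot0 -Ex; exact: dx.
  have := (cvgr_dnbhsP _ _ _).1 quot harmonic
    (conj (fun n => lt0r_neq0 (harmonic_gt0 n)) cvg_harmonic).
  rewrite (_ : (fun n => _) = (fun n => q n x))//; apply/funext => n.
  by rewrite /phi /= addr0 rot0 [harmonic n *: 1]mulr1.
have iM : (surface_measure R d).-integrable (sphere R d) (fun=> M%:E).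
  by apply: (integrable_continuous_sphere _ _ (fun=> M)) => x _; exact: cst_continuous.
(* By the mean value theorem each quotient is a value of [D] at a rotated point of the sphere, so
   the bound [M] of [D] there dominates all of them. *)
have qM : {ae surface_measure R d, forall x n, sphere R d x ->
    (`|(q n x)%:E| <= M%:E)%E}.
  apply: aeW => x n Sx; rewrite abse_EFin lee_fin /q normrM normfV.
  have t0 : 0 < @harmonic R n := harmonic_gt0 n.
  rewrite (ger0_norm (ltW t0)) mulrC ler_pdivrMr//.
  have [c _] := @MVT R (fun u => H (rot u x)) (fun u => D (rot u x)) 0 (harmonic n) t0
    (fun u _ => dphi x u Sx)
    (derivable_within_continuous (fun u _ => @ex_derive _ _ _ _ _ _ _ (dphi x u Sx))).
  rewrite rot0 subr0 => ->.
  by rewrite normrM (ger0_norm (ltW t0)) ler_wpM2r ?(ltW t0)// DM//; exact: Srot.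
have [_ _ lim] := dominated_convergence mS mq mD qD iM qM.
rewrite -(cvg_lim (@ereal_hausdorff R) lim).
by under eq_fun do rewrite q0; rewrite lim_cst.
Qed.

(** * Integration by parts from the Leibniz rule *)

Theorem proposition8p4 (R : realType) (d : nat) (f g : 'rV[R]_d -> R)
    (i j : 'I_d) :
  (2 <= d)%N -> C1_sphere f -> C1_sphere g -> i != j ->
  (\int[surface_measure R d]_(x in sphere R d)
      (f x * sphere_derive i j g x)%:E =
   - \int[surface_measure R d]_(x in sphere R d)
      (sphere_derive i j f x * g x)%:E)%E.
Proof.
move=> _ Cf Cg ij; have mS := @measurable_sphere R d.
(* The radial extensions are differentiable off the origin and agree with [f] and [g] on the sphere,
   so they can replace them under the integrals. *)
pose F := radial_ext f; pose G := radial_ext g.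
have FE x : sphere R d x -> F x = f x.
  by move=> Sx; rewrite /F /radial_ext /= /proj_sphere Sx invr1 scale1r.
have GE x : sphere R d x -> G x = g x.
  by move=> Sx; rewrite /G /radial_ext /= /proj_sphere Sx invr1 scale1r.
have cont h x : C1_sphere h -> sphere R d x -> {for x, continuous (radial_ext h)}.
  by move=> Ch /sphere_neq0 /Ch[/differentiable_continuous].
have dcont h x : C1_sphere h -> sphere R d x ->
    {for x, continuous (sphere_derive i j h)}.
  move=> Ch /sphere_neq0 /Ch[_ dh].
  by apply: continuousB; apply: continuousM => //; exact: coord_continuous.
have cFdG x : sphere R d x -> {for x, continuous (fun y => F y * sphere_derive i j g y)}.
  by move=> Sx; apply: continuousM; [exact: cont|exact: dcont].
have cdFG x : sphere R d x -> {for x, continuous (fun y => sphere_derive i j f y * G y)}.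
  by move=> Sx; apply: continuousM; [exact: dcont|exact: cont].
have iFdG := integrable_continuous_sphere _ _ _ cFdG.
have idFG := integrable_continuous_sphere _ _ _ cdFG.
have : (\int[surface_measure R d]_(x in sphere R d)
    (F x * sphere_derive i j g x + sphere_derive i j f x * G x)%:E = 0)%E.
  apply: (@integral_angular_derive _ _ i j (F * G)) => //.
  - by move=> x /[dup] /Cf[dF _] /Cg[dG _]; exact: differentiableM.
  - by move=> x Sx; apply: continuousD; [exact: cFdG|exact: cdFG].
  - have leibniz (u v a b p p' q q' : R) :
        u * (a * p' - b * q') + (a * p - b * q) * v =
        a * (u * p' + v * p) - b * (u * q' + v * q) by ring.
    move=> x Sx; have x0 := sphere_neq0 Sx.
    have [[dF _] [dG _]] := (Cf x x0, Cg x x0).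
    rewrite /sphere_derive /angular_derive !deriveM; try exact: diff_derivable.
    exact: leibniz.
under eq_integral do rewrite EFinD.
rewrite (integralD mS iFdG idFG) /= => E.
have -> : (\int[surface_measure R d]_(x in sphere R d)
    (f x * sphere_derive i j g x)%:E = \int[surface_measure R d]_(x in sphere R d)
    (F x * sphere_derive i j g x)%:E)%E.
  by apply: eq_integral => x; rewrite inE => Sx; rewrite FE.
have -> : (\int[surface_measure R d]_(x in sphere R d)
    (sphere_derive i j f x * g x)%:E = \int[surface_measure R d]_(x in sphere R d)
    (sphere_derive i j f x * G x)%:E)%E.
  by apply: eq_integral => x; rewrite inE => Sx; rewrite GE.
(* In the extended reals a term can be moved across the equation [E] only if it is finite, which
   integrability provides. *)
have fdFG := integrable_fin_num mS idFG.
by rewrite -[LHS](addeK _ fdFG) [X in (X - _)%E]E add0e.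
Qed.
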